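(* Let $A\subseteq\mathbb{R}^2$ be a compact set such that $\mathbb{R}^2=A+\mathbb{Z}^2$ (i.e., for every $x\in\mathbb{R}^2$ there is $y\in A$ with $y-x\in\mathbb{Z}^2$). Then there exist $x,y\in A$ such that $x-y\in(\mathbb{Z}\setminus\{0\})^2$.
   Context: For sets $A,B$ in an abelian group, $A+B=\{a+b:a\in A,\ b\in B\}$. *)

(* Defs.v *)
From mathcomp Require Import all_boot all_order all_algebra.
From mathcomp Require Import all_classical all_reals all_analysis.

Set Implicit Arguments.
Unset Strict Implicit.
Unset Printing Implicit Defensive.

Import Order.TTheory GRing.Theory Num.Theory.
Import numFieldNormedType.Exports.

Local Open Scope classical_set_scope.
Local Open Scope ring_scope.

Definition sumset (V : zmodType) (A B : set V) : set V :=
  [set a + b | a in A & b in B].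

Definition Zset (R : realType) : set R := range (fun n : int => n%:~R).
Arguments Zset : clear implicits.

(* Main.v *)
(* Suppose no two points of A differ by an integer vector with both coordinates
   nonzero.  Choose a Z^2-equivariant c : R^2 -> Z^2 with p + c p in A.  By
   compactness of A - A, c p - c q has a zero coordinate as soon as p and q are
   close enough, so on a fine grid the images under c of the vertices of any small
   triangle lie on a common horizontal or vertical line and span zero signed area.
   Summing over the unit square, only the boundary terms survive; by
   equivariance they give twice the area of a unit square, that is 2, which is
   absurd. *)
Require Import Defs.
From mathcomp Require Import all_boot all_order all_algebra.
From mathcomp Require Import all_classical all_reals all_analysis.
From mathcomp Require Import ring lra zify.

Set Implicit Arguments.
Unset Strict Implicit.
Unset Printing Implicit Defensive.

Import Order.TTheory GRing.Theory Num.Theory.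
Import numFieldNormedType.Exports.

Local Open Scope classical_set_scope.
Local Open Scope ring_scope.

(** Two of the three pairs agree in the same coordinate and share a vertex, so all three points are
    collinear; the sum is twice their signed area. *)
Lemma cross_sum_axis_triangle (R : comPzRingType) (a0 b0 a1 b1 a2 b2 : R) :
  a0 = a1 \/ b0 = b1 -> a1 = a2 \/ b1 = b2 -> a0 = a2 \/ b0 = b2 ->
  (a0 * b1 - b0 * a1) + (a1 * b2 - b1 * a2) + (a2 * b0 - b2 * a0) = 0.
Proof. by do 3![case=> ?]; subst; ring. Qed.

Lemma no_axis_labelling (N : nat) (a b : nat -> nat -> int) :
  (forall i j i' j', (i <= i' <= i.+1)%N -> (j <= j' <= j.+1)%N ->
    a i j = a i' j' \/ b i j = b i' j') ->
  (forall j, a N j = a 0%N j - 1) -> (forall j, b N j = b 0%N j) ->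
  (forall i, a i N = a i 0%N) -> (forall i, b i N = b i 0%N - 1) ->
  False.
Proof.
move=> adj aN bN aT bT.
(* h and v are the cross products along horizontal and vertical grid edges; cell
   says that their circulation around each grid square vanishes. *)
pose h i j := a i j * b i.+1 j - b i j * a i.+1 j.
pose v i j := a i j * b i j.+1 - b i j * a i j.+1.
have kk k : (k <= k <= k.+1)%N by rewrite leqnn leqnSn.
have kS k : (k <= k.+1 <= k.+1)%N by rewrite leqnn leqnSn.
have cell i j : h i j.+1 - h i j = v i.+1 j - v i j.
  (* The square is cut into two triangles that both return along the same diagonal, so the diagonal
     terms cancel in [E2 - E1]. *)
  have E1 := cross_sum_axis_triangle (adj i j i.+1 j (kS i) (kk j))
    (adj i.+1 j i.+1 j.+1 (kk _) (kS _)) (adj i j i.+1 j.+1 (kS i) (kS j)).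
  have E2 := cross_sum_axis_triangle (adj i j i j.+1 (kk i) (kS j))
    (adj i j.+1 i.+1 j.+1 (kS _) (kk _)) (adj i j i.+1 j.+1 (kS i) (kS j)).
  apply/eqP; rewrite -subr_eq0 -[X in _ == X](subrr 0) -{1}E2 -E1 /h /v.
  by apply/eqP; ring.
have : \sum_(0 <= i < N) \sum_(0 <= j < N) (h i j.+1 - h i j)
     = \sum_(0 <= j < N) \sum_(0 <= i < N) (v i.+1 j - v i j).
  by rewrite exchange_big_nat; do 2![apply: eq_bigr => ? _].
under eq_bigr do rewrite telescope_sumr//.
under [RHS]eq_bigr do rewrite telescope_sumr//.
have -> : \sum_(0 <= i < N) (h i N - h i 0%N)
        = \sum_(0 <= i < N) (a i.+1 0%N - a i 0%N).
  by apply: eq_bigr => i _; rewrite /h !aT !bT; ring.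
have -> : \sum_(0 <= j < N) (v N j - v 0%N j)
        = \sum_(0 <= j < N) - (b 0%N j.+1 - b 0%N j).
  by apply: eq_bigr => j _; rewrite /v !aN !bN; ring.
(* The left side becomes [a N 0 - a 0 0 = -1], the right side [-(b 0 N - b 0 0) = 1]. *)
rewrite sumrN !telescope_sumr// aN bT; lia.
Qed.

(** If [t] is an integer it must be 0, and [r = 1] works; otherwise [r] is the distance to the
    nearest integer. *)
Lemma nonzero_int_separated (R : realType) (t : R) :
  ~ (Zset R `\ 0) t ->
  exists2 r : R, 0 < r & forall n : int, n != 0 -> r <= `|t - n%:~R|.
Proof.
move=> tZ.
have /andP[ft tf] := floor_itv t.
have [te|tN] := eqVneq t (Num.floor t)%:~R.
  have f0 : Num.floor t = 0.
    apply/eqP; apply: contra_notT tZ => f0; split; first by exists (Num.floor t).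
    by move=> t0; move/negP: f0; apply; rewrite t0 floor0.
  exists 1 => // n n0; rewrite te f0 sub0r normrN -intr_norm ler1z.
  lia.
have lt_ft : (Num.floor t)%:~R < t by rewrite lt_neqAle eq_sym tN.
exists (Num.min (t - (Num.floor t)%:~R) ((Num.floor t + 1)%:~R - t)).
  by rewrite lt_min !subr_gt0 lt_ft.
move=> n _; rewrite ge_min; have [nf|fn] := leP n (Num.floor t).
  apply/orP; left; rewrite (le_trans _ (ler_norm _))// lerD2l lerN2 ler_int.
  exact: nf.
apply/orP; right; rewrite distrC (le_trans _ (ler_norm _))// lerD2r ler_int.
lia.
Qed.

(** Each point of [D] has a coordinate that is not a nonzero integer. Its gap gives a bound valid
    nearby and for all large [N]; compactness makes [N] uniform. *)
Lemma compact_nonzero_int_separated (R : realType) (D : set (R * R)) :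
  compact D -> D `&` ((Zset R `\ 0) `*` (Zset R `\ 0)) = set0 ->
  exists N : nat, forall z, D z -> forall m n : int, m != 0 -> n != 0 ->
    N.+1%:R^-1 < `|z.1 - m%:~R| \/ N.+1%:R^-1 < `|z.2 - n%:~R|.
Proof.
move=> /compact_near_coveringP cD D0.
pose P (N : nat) (z : R * R) := forall m n : int, m != 0 -> n != 0 ->
    N.+1%:R^-1 < `|z.1 - m%:~R| \/ N.+1%:R^-1 < `|z.2 - n%:~R|.
have key (r : R) : 0 < r -> \forall N \near \oo, N.+1%:R^-1 < r / 2.
  move=> r0; have r20 : 0 < r / 2 by rewrite divr_gt0.
  exact: near_infty_natSinv_lt (PosNum r20).
(* Half of the gap pays for moving from [t] to [t']; the other half remains. *)
have sep (r t t' s : R) : r <= `|t - s| -> `|t - t'| < r / 2 -> r / 2 < `|t' - s|.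
  move=> rts tt'; have := ler_distD t' t s; lra.
suff /cD : forall z, D z -> \forall z' \near z & N \near \oo, P N z'.
  by case=> N _ /(_ N (leqnn _)) HN; exists N => z /HN.
move=> z Dz.
have [z1|z1] := pselect ((Zset R `\ 0) z.1); last first.
  have [r r0 rP] := nonzero_int_separated z1.
  exists (ball z (r / 2), [set N : nat | N.+1%:R^-1 < r / 2]).
    by split; [apply: nbhsx_ballx; rewrite divr_gt0|exact: key].
  move=> [z' N] /= [[b1 _] Nr] m n m0 n0; left.
  exact: lt_trans Nr (sep _ _ _ _ (rP _ m0) b1).
have [z2|z2] := pselect ((Zset R `\ 0) z.2).
  by have : set0 z by rewrite -D0; split.
have [r r0 rP] := nonzero_int_separated z2.
exists (ball z (r / 2), [set N : nat | N.+1%:R^-1 < r / 2]).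
  by split; [apply: nbhsx_ballx; rewrite divr_gt0|exact: key].
move=> [z' N] /= [[_ b2] Nr] m n m0 n0; right.
exact: lt_trans Nr (sep _ _ _ _ (rP _ n0) b2).
Qed.

Theorem theorem1 (R : realType) (A : set (R * R)) :
  compact A ->
  [set: R * R] = sumset A (Zset R `*` Zset R) ->
  exists x y : R * R,
    [/\ A x, A y & ((Zset R `\ 0) `*` (Zset R `\ 0)) (x - y)].
Proof.
move=> cA covA; apply: contrapT => noxy.
pose D := (fun p : (R * R) * (R * R) => p.1 - p.2) @` (A `*` A).
have cD : compact D.
  apply: continuous_compact; last exact: compact_setX.
  apply: continuous_subspaceT => p.
  by apply: cvgB; [exact: cvg_fst|exact: cvg_snd].
have D0 : D `&` ((Zset R `\ 0) `*` (Zset R `\ 0)) = set0.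
  rewrite -subset0 => _ [[[x y] [/= Ax Ay] <-] Zxy]; apply: noxy.
  by exists x, y.
have [M sepD] := compact_nonzero_int_separated cD D0.
have lift (p : R * R) :
    exists k : int * int, A (p.1 + k.1%:~R, p.2 + k.2%:~R).
  have : [set: R * R] p by [].
  rewrite covA => -[x Ax [[k1 k2] [/= [m _ <-] [n _ <-]] <-]].
  exists (- m, - n); rewrite /= !mulrNz !addrK.
  by case: x Ax.
have [c0 c0P] := choice lift.
(* Choosing on fractional parts only makes [c] drop by exactly 1 in a coordinate when that argument
   grows by 1. *)
pose c (x y : R) : int * int :=
  let k := c0 (x - (Num.floor x)%:~R, y - (Num.floor y)%:~R) in
  (k.1 - Num.floor x, k.2 - Num.floor y).
have cP x y : A (x + (c x y).1%:~R, y + (c x y).2%:~R).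
  have := c0P (x - (Num.floor x)%:~R, y - (Num.floor y)%:~R).
  by rewrite /c /= !intrB !addrA !(addrAC _ (- _) _).
(* The mesh [1/(M+2)] lies below the separation [1/(M+1)] from [sepD]. *)
pose g (i : nat) : R := i%:R / M.+2%:R.
have gM : g M.+2 = 1 by rewrite /g divff.
have g0 : g 0 = 0 by rewrite /g mul0r.
have step i i' : (i <= i' <= i.+1)%N -> `|g i' - g i| <= M.+2%:R^-1.
  move=> /andP[ii' i'i]; rewrite /g -mulrBl -natrB// normrM normr_nat.
  rewrite ger0_norm ?invr_ge0// ler_piMl ?invr_ge0// lern1; lia.
apply: (@no_axis_labelling M.+2 (fun i j => (c (g i) (g j)).1)
   (fun i j => (c (g i) (g j)).2)).
- move=> i j i' j' ii' jj'; apply: contrapT => /not_orP[/eqP ne1 /eqP ne2].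
  pose l i j := (g i + (c (g i) (g j)).1%:~R, g j + (c (g i) (g j)).2%:~R).
  have Dl : D (l i' j' - l i j).
    by exists (l i' j', l i j) => //; split; exact: cP.
  have := sepD _ Dl
    ((c (g i') (g j')).1 - (c (g i) (g j)).1)
    ((c (g i') (g j')).2 - (c (g i) (g j)).2).
  rewrite !subr_eq0 eq_sym ne1 eq_sym ne2 => /(_ isT isT) /=.
  (* Subtracting the label difference leaves only the displacement of grid points, at most one mesh
     step per coordinate. *)
  have E (x u y v : R) : x + u - (y + v) - (u - v) = x - y by ring.
  rewrite !intrB !E.
  have lMM : M.+2%:R^-1 <= M.+1%:R^-1 :> R by rewrite lef_pV2 ?posrE// ler_nat.
  have := step _ _ ii'; have := step _ _ jj'.
  by move=> s1 s2 []; rewrite ltNge (le_trans _ lMM).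
- by move=> j; rewrite gM g0 /c /= floor1 floor0 !subrr !subr0.
- by move=> j; rewrite gM g0 /c /= floor1 floor0 !subrr.
- by move=> i; rewrite gM g0 /c /= floor1 floor0 !subrr.
- by move=> i; rewrite gM g0 /c /= floor1 floor0 !subrr !subr0.
Qed.
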